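(* Let $N\in\mathbb{N}$. For any weight matrix $\tilde W=(\tilde w_{i,j})\in(\mathbb{R}_0^+)^{N\times N}$ with $\tilde w_{i,i}>0$ for all $i$, all $N$ positions $v_i$ which evolve according to $$\partial_t v_i=\sum_{j\in J_2^i}\tilde w_{i,j}\,\Phi(v_j-v_i)-\sum_{j=1}^N\tilde w_{i,j}\,\Phi(v_j+v_i),\qquad i=1,\ldots,N,$$ and have arbitrary initial values in $(0,1)$ do not reach the domain boundaries $0$ and $1$ for any time $t\ge 0$.
   Context: $J_2^i:=\{j\in\{1,\ldots,N\}\mid v_j\neq v_i\}$ (depending on the current positions). Penaliser and flux: $\Psi:\mathbb{R}_0^+\to\mathbb{R}$ is such that $s\mapsto\Psi(s^2)$ is continuously differentiable, decreasing and strictly convex on $[0,1]$, with $\Psi(0)=0$ and vanishing left-sided derivative at $s=1$. It is extended to $[-1,1]$ by symmetry (evenness) and to $\mathbb{R}$ by periodicity $\Psi((2+s)^2)=\Psi(s^2)$. The flux is $\Phi(s):=\Psi'(s^2)\,s$, i.e. half the derivative of $s\mapsto\Psi(s^2)$, defined for $s$ not an even integer. Hence $\Phi(-s)=-\Phi(s)$, $\Phi(2+s)=\Phi(s)$, $\Phi$ is continuous and increasing on $(0,2)$, $\Phi(1)=0$, and $\Phi$ has jump discontinuities at the even integers. *)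

(* Defs.v *)
From HB Require Import structures.
From mathcomp Require Import all_boot all_order all_algebra.
From mathcomp Require Import all_classical all_reals all_analysis.

Set Implicit Arguments.
Unset Strict Implicit.
Unset Printing Implicit Defensive.

Import Order.TTheory GRing.Theory Num.Theory.
Import numFieldNormedType.Exports.

Local Open Scope classical_set_scope.
Local Open Scope ring_scope.

(* Derivative of [f] at [x] relative to [A]: at an endpoint of an interval [A]
   this is the one-sided derivative. *)
Definition has_derivative_within (R : realType) (A : set R) (f : R -> R)
    (x l : R) : Prop :=
  (f y - f x) / (y - x) @[y --> within A x^'] --> l.

Definition continuously_differentiable_on (R : realType) (A : set R)
    (f : R -> R) : Prop :=
  exists2 g : R -> R, {within A, continuous g} &
    forall x, A x -> has_derivative_within A f x (g x).

Definition strictly_decreasing_on (R : realType) (A : set R)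
    (f : R -> R) : Prop :=
  forall x y, A x -> A y -> x < y -> f y < f x.

Definition strictly_convex_on (R : realType) (A : set R)
    (f : R -> R) : Prop :=
  forall x y t, A x -> A y -> x != y -> 0 < t -> t < 1 ->
    f ((1 - t) * x + t * y) < (1 - t) * f x + t * f y.

(* [Psi] is only meaningful on the nonnegative half-line: it is always applied
   to squares. In particular the extension of [s |-> Psi (s ^+ 2)] to [-1, 1] by
   evenness is automatic. *)
Record penaliser (R : realType) (Psi : R -> R) : Prop := Penaliser {
  penaliser_C1 :
    continuously_differentiable_on `[0, 1] (fun s => Psi (s ^+ 2));
  penaliser_decreasing :
    strictly_decreasing_on `[0, 1] (fun s => Psi (s ^+ 2));
  penaliser_convex :
    strictly_convex_on `[0, 1] (fun s => Psi (s ^+ 2));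
  penaliser0 : Psi 0 = 0;
  penaliser_left_derivative1 :
    (Psi (s ^+ 2) - Psi (1 ^+ 2)) / (s - 1) @[s --> 1^'-] --> (0 : R);
  penaliser_periodic : forall s, Psi ((2 + s) ^+ 2) = Psi (s ^+ 2)
}.

(* Meaningful only when [s] is not an even integer; elsewhere the value is
   irrelevant, since [evolves] never evaluates the flux at such points. *)
Definition flux (R : realType) (Psi : R -> R) (s : R) : R :=
  derive1 Psi (s ^+ 2) * s.

Definition velocity (R : realType) (N : nat) (Psi : R -> R) (W : 'M[R]_N)
    (x : 'I_N -> R) (i : 'I_N) : R :=
  \sum_(j < N | x j != x i) W i j * flux Psi (x j - x i)
  - \sum_(j < N) W i j * flux Psi (x j + x i).

(* [v i t] is the position of particle [i] at time [t], and [J] is the time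
   interval on which the evolution is considered. The differential equation is
   imposed at the interior times at which all positions lie in (0, 1): at a
   time when some position equals 0 or 1 the flux term with [j = i] in the
   second sum is undefined. *)
Definition evolves (R : realType) (N : nat) (Psi : R -> R) (W : 'M[R]_N)
    (J : set R) (v : 'I_N -> R -> R) : Prop :=
  (forall i, {within J, continuous (v i)}) /\
  (forall t, J° t -> (forall j, 0 < v j t < 1) ->
    forall i, is_derive t 1 (v i) (velocity Psi W (fun j => v j t) i)).

(* Main.v *)
(* Write g for the derivative of s |-> Psi (s^2) on [0, 1]. On (0, 2) the flux
   agrees with a function (flux_ext g) that is continuous up to 0, where its
   value is negative. If v_i is the first position to reach 0, at time T, the
   j-th terms Phi(v_j - v_i) - Phi(v_j + v_i) cancel in the limit or are
   nonnegative, except that the self-interaction -Phi(2 v_i) tends to the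
   positive number -Phi(0+). So v_i is increasing shortly before T, which is
   absurd. The boundary 1 reduces to the boundary 0 because 1 - v solves the
   same system. *)
Require Import Defs.
From mathcomp Require Import all_boot all_order all_algebra.
From mathcomp Require Import all_classical all_reals all_analysis.
From mathcomp Require Import ring lra.

Import Order.TTheory GRing.Theory Num.Theory.
Import numFieldNormedType.Exports.

Local Open Scope classical_set_scope.
Local Open Scope ring_scope.

(** * One-sided limits and clamping to the unit interval *)

Lemma is_derive_quotient {R : realType} {f : R -> R} {x l : R} :
  (f y - f x) / (y - x) @[y --> x^'] --> l -> is_derive x 1 f l.
Proof.
move=> fxl.
have cvg_shift : (h + x) @[h --> 0^'] --> x^'.
  have shiftx : (h + x) @[h --> 0] --> x.
    rewrite -[X in _ --> X]add0r.
    by apply: cvgD; [exact: cvg_id|exact: cvg_cst].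
  move=> A xA.
  apply: (@filterS _ (nbhs (0 : R)) _ (fun h => h + x != x -> A (h + x))).
    2: exact: shiftx xA.
  move=> h hA h0.
  by apply: hA; rewrite -subr_eq0 addrK.
have fl : h^-1 *: ((f \o shift x) (h *: 1) - f x) @[h --> 0^'] --> l.
  have := cvg_comp _ _ cvg_shift fxl.
  apply: cvg_trans; apply: near_eq_cvg; near=> h.
  by rewrite /= addrK mulrC -[X in _ = _^-1 *: (f (X + x) - f x)]/(h * 1) mulr1.
by apply: DeriveDef; [apply/cvg_ex; exists l | apply/cvg_lim].
Unshelve. all: by end_near. Qed.

(** Composing with this retraction of the line onto [0, 1] turns continuity within [0, 1] into plain
    continuity. *)
Definition clamp {R : realType} (s : R) : R := Num.max 0 (Num.min 1 s).

Lemma clamp_itv {R : realType} (s : R) : 0 <= clamp s <= 1.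
Proof. by rewrite /clamp le_max lexx /= ge_max ler01 ge_min lexx. Qed.

Lemma clamp_id {R : realType} (s : R) : 0 <= s <= 1 -> clamp s = s.
Proof. by move=> /andP[s0 s1]; rewrite /clamp min_r// max_r. Qed.

Lemma clamp_ge1 {R : realType} (s : R) : 1 <= s -> clamp s = 1.
Proof. by move=> s1; rewrite /clamp min_l// max_r. Qed.

Lemma continuous_clamp {R : realType} : continuous (@clamp R).
Proof.
move=> x; apply: (@continuous_max R R^o (cst 0) (fun s => Num.min 1 s)).
  exact: cvg_cst.
by apply: (@continuous_min R R^o (cst 1) id); [exact: cvg_cst|exact: cvg_id].
Qed.

Lemma continuous_comp_clamp {R : realType} (g : R -> R) :
  {within `[0, 1], continuous g} -> continuous (g \o clamp).
Proof.
move=> /subspace_continuousP gc x; apply: (@cvg_comp _ _ _ clamp g); last first.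
  by apply: (gc (clamp x)); rewrite /= in_itv /= clamp_itv.
move=> A xA.
apply: (@filterS _ (nbhs x) _
  (fun y => `[0, 1]%classic (clamp y) -> A (clamp y))).
  2: exact: continuous_clamp xA.
by move=> y; apply; rewrite /= in_itv /= clamp_itv.
Qed.

(** Turns derivatives relative to [0, 1] into one-sided ones; the case [x = a] serves the derivative
    at 0. *)
Lemma at_right_within_itv {R : realType} (a b x : R) : a <= x -> x < b ->
  x^'+ `=>` within `[a, b] x^'.
Proof.
move=> ax xb A xA.
apply: (@filterS2 _ (nbhs x) _ (fun y => x < y -> y <= b)
  (fun y => y != x -> `[a, b]%classic y -> A y)).
- move=> y yb yA xy; apply: yA; first by rewrite gt_eqF.
  by rewrite /= in_itv /= (le_trans ax (ltW xy)) yb.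
- exact: (nbhs_right_ltW xb).
- exact: xA.
Qed.

Lemma at_left_within_itv {R : realType} (a b x : R) : a < x -> x <= b ->
  x^'- `=>` within `[a, b] x^'.
Proof.
move=> ax xb A xA.
apply: (@filterS2 _ (nbhs x) _ (fun y => y < x -> a <= y)
  (fun y => y != x -> `[a, b]%classic y -> A y)).
- move=> y ya yA yx; apply: yA; first by rewrite lt_eqF.
  by rewrite /= in_itv /= ya//= (le_trans (ltW yx)).
- exact: (nbhs_left_ge ax).
- exact: xA.
Qed.

Lemma cvg_right_left_dnbhs {R : realType} (f : R -> R) (p l : R) :
  f x @[x --> p^'+] --> l -> f x @[x --> p^'-] --> l -> f x @[x --> p^'] --> l.
Proof.
move=> fr fl A Al.
apply: (@filterS2 _ (nbhs p) _ (fun x => p < x -> A (f x))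
  (fun x => x < p -> A (f x))); [|exact: fr Al|exact: fl Al].
by move=> x xr xl; rewrite neq_lt => /orP[/xl|/xr].
Qed.

(** * Derivative of the penaliser and continuous extension of the flux *)

Lemma penaliser_sym {R : realType} {Psi : R -> R}
    (hPsi : penaliser Psi) (s : R) :
  Psi ((2 - s) ^+ 2) = Psi (s ^+ 2).
Proof. by rewrite (penaliser_periodic hPsi) sqrrN. Qed.

Definition is_derivative_on01 {R : realType} (Psi g : R -> R) : Prop :=
  forall s, `[0, 1]%classic s ->
    has_derivative_within `[0, 1] (fun s => Psi (s ^+ 2)) s (g s).

Lemma penaliser_derivative1 {R : realType} {Psi g : R -> R} :
  penaliser Psi -> is_derivative_on01 Psi g -> g 1 = 0.
Proof.
move=> hPsi hg.
have g1 : (Psi (s ^+ 2) - Psi (1 ^+ 2)) / (s - 1) @[s --> 1^'-] --> g 1.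
  apply: cvg_trans (hg 1 _); last by rewrite /= in_itv /= ler01 lexx.
  by apply: cvg_app; exact: at_left_within_itv.
exact: (cvg_unique _ g1 (penaliser_left_derivative1 hPsi)).
Qed.

(** Below 1 the derivative is [g]; above 1 it follows by the reflection s -> 2 - s. At 1 the left
    derivative vanishes by assumption, hence so does its mirror image on the right. *)
Lemma is_derive_penaliser {R : realType} {Psi g : R -> R} :
  penaliser Psi -> is_derivative_on01 Psi g -> forall s : R, 0 < s < 2 ->
  is_derive s 1 (fun s => Psi (s ^+ 2)) (g (clamp s) - g (clamp (2 - s))).
Proof.
move=> hPsi hg; have g1 := penaliser_derivative1 hPsi hg.
have lt1 (s : R) : 0 < s < 1 -> is_derive s 1 (fun s => Psi (s ^+ 2)) (g s).
  move=> /andP[s0 s1]; apply: is_derive_quotient.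
  have s01 : `[0, 1]%classic s by rewrite /= in_itv /= !ltW.
  apply: cvg_right_left_dnbhs; apply: cvg_trans (hg s s01); apply: cvg_app.
    by apply: at_right_within_itv => //; exact: ltW.
  by apply: at_left_within_itv => //; exact: ltW.
move=> s /andP[s0 s2]; have [s1|s1|->] := ltgtP s 1.
- rewrite (@clamp_ge1 _ (2 - s)); last by lra.
  by rewrite g1 subr0 clamp_id ?(ltW s0) ?ltW//; apply: lt1; rewrite s0.
- rewrite clamp_ge1 ?ltW// g1 sub0r clamp_id; last by apply/andP; split; lra.
  rewrite -mulrN1.
  apply: (@near_eq_is_derive _ _ _
    ((fun s => Psi (s ^+ 2)) \o (fun s => 2 - s))).
    by near=> y; rewrite /= penaliser_sym.
  apply: is_derive1_comp; first by apply: lt1; apply/andP; split; lra.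
  by apply: is_derive_eq; rewrite add0r mul1r.
- rewrite !clamp_ge1 ?subrr ?lexx//; last by lra.
  apply: is_derive_quotient.
  apply: cvg_right_left_dnbhs; last exact: penaliser_left_derivative1.
  have cvg_refl : (2 - y : R) @[y --> (1 : R)^'+] --> (1 : R)^'-.
    have refl1 : (2 - y : R) @[y --> (1 : R)] --> (1 : R).
      rewrite [X in _ --> X](_ : _ = 2 - 1); last by lra.
      by apply: cvgB; [exact: cvg_cst|exact: cvg_id].
    move=> A A1.
    apply: (@filterS _ (nbhs (1 : R)) _ (fun y => 2 - y < 1 -> A (2 - y))).
      2: exact: refl1 A1.
    by move=> y yA y1; apply: yA; lra.
  have := cvgN (cvg_comp _ _ cvg_refl (penaliser_left_derivative1 hPsi)).
  rewrite oppr0 => /(_ _); apply: cvg_trans; apply: near_eq_cvg; near=> y.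
  rewrite /= !fctE /= penaliser_sym// -mulrN -invrN; congr (_ / _); lra.
Unshelve. all: by end_near. Qed.

(* As g 1 = 0, the second term vanishes on [0, 1] and the first on [1, 2]. *)
Definition flux_ext {R : realType} (g : R -> R) (s : R) : R :=
  (g (clamp s) - g (clamp (2 - s))) / 2.

(** Near [s ^+ 2] > 0, [Psi] is s -> [Psi (s ^+ 2)] composed with the square root. The chain rule
    brings a factor 1 / (2 s), whose s cancels against the one in [flux]. *)
Lemma flux_extE {R : realType} {Psi g : R -> R} :
  penaliser Psi -> is_derivative_on01 Psi g -> forall s : R, 0 < s < 2 ->
  flux Psi s = flux_ext g s.
Proof.
move=> hPsi hg s s02; have /andP[s0 _] := s02.
have s20 : 0 < s ^+ 2 by rewrite exprn_gt0.
have dPsi : is_derive (s ^+ 2) 1 Psi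
    ((g (clamp s) - g (clamp (2 - s))) * (2 * Num.sqrt (s ^+ 2))^-1).
  apply: (@near_eq_is_derive _ _ _ ((fun s => Psi (s ^+ 2)) \o Num.sqrt)).
    by near=> y; rewrite /= sqr_sqrtr//; near: y; exact: lt_le_nbhsr.
  apply: is_derive1_comp; last exact: is_derive1_sqrt.
  by rewrite sqrtr_sqr gtr0_norm//; exact: is_derive_penaliser.
rewrite /flux derive1E derive_val sqrtr_sqr gtr0_norm// /flux_ext.
by field; rewrite gt_eqF.
Unshelve. all: by end_near. Qed.

Lemma fluxN {R : realType} (Psi : R -> R) s : flux Psi (- s) = - flux Psi s.
Proof. by rewrite /flux sqrrN mulrN. Qed.

Lemma flux_ext_refl {R : realType} (g : R -> R) s :
  flux_ext g (2 - s) = - flux_ext g s.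
Proof. by rewrite /flux_ext subKr -mulNr opprB. Qed.

Lemma continuous_flux_ext {R : realType} (g : R -> R) :
  {within `[0, 1], continuous g} -> continuous (flux_ext g).
Proof.
move=> /continuous_comp_clamp gc x; apply: cvgM; last exact: cvg_cst.
apply: cvgB; first exact: gc.
apply: (@cvg_comp _ _ _ (fun s => 2 - s) (g \o clamp)); last exact: gc.
by apply: cvgB; [exact: cvg_cst|exact: cvg_id].
Qed.

(** * Sign of the extended flux *)

Lemma derivative_on01_le0 {R : realType} {Psi g : R -> R} :
  penaliser Psi -> is_derivative_on01 Psi g ->
  forall s : R, 0 <= s <= 1 -> g s <= 0.
Proof.
move=> hPsi hg s /andP[s0]; rewrite le_eqVlt => /predU1P[->|s1].
  by rewrite (penaliser_derivative1 hPsi hg).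
have gs : (Psi (y ^+ 2) - Psi (s ^+ 2)) / (y - s) @[y --> s^'+] --> g s.
  apply: cvg_trans (hg s _); last by rewrite /= in_itv /= s0 ltW.
  by apply: cvg_app; exact: at_right_within_itv.
apply: (cvgr_to_le gs); near=> y.
have sy : s < y by near: y; exact: nbhs_right_gt.
have y1 : y <= 1 by near: y; exact: nbhs_right_ltW.
rewrite ler_pdivrMr ?subr_gt0// mul0r subr_le0 ltW//.
by apply: (penaliser_decreasing hPsi) => //;
  rewrite /= in_itv /= ?s0 ?(ltW s1) ?y1//
  (le_trans s0 (ltW sy)).
Unshelve. all: by end_near. Qed.

Lemma flux_ext_le0 {R : realType} {Psi g : R -> R} :
  penaliser Psi -> is_derivative_on01 Psi g ->
  forall s : R, 0 <= s <= 1 -> flux_ext g s <= 0.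
Proof.
move=> hPsi hg s s01; rewrite /flux_ext clamp_id// clamp_ge1; last by lra.
rewrite (penaliser_derivative1 hPsi hg) subr0.
by have := derivative_on01_le0 hPsi hg _ s01; lra.
Qed.

(* Strict convexity keeps the slopes at 0 below the slope of the chord over
   [0, 1], which is negative. *)
Lemma flux_ext0_lt0 {R : realType} {Psi g : R -> R} :
  penaliser Psi -> is_derivative_on01 Psi g -> flux_ext g 0 < 0.
Proof.
move=> hPsi hg.
have in01 (x : R) : 0 <= x <= 1 -> `[0, 1]%classic x by rewrite /= in_itv.
have P1 : Psi (1 ^+ 2) < Psi (0 ^+ 2).
  by apply: (penaliser_decreasing hPsi) ltr01; apply: in01; rewrite lexx ler01.
have g0 : (Psi (y ^+ 2) - Psi (0 ^+ 2)) / (y - 0) @[y --> 0^'+] --> g 0.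
  apply: cvg_trans (hg 0 _); last by apply: in01; rewrite lexx ler01.
  by apply: cvg_app; exact: at_right_within_itv.
have : g 0 <= Psi (1 ^+ 2) - Psi (0 ^+ 2).
  apply: (cvgr_to_le g0); near=> y.
  have y0 : 0 < y by near: y; exact: nbhs_right_gt.
  have y1 : y < 1 by near: y; exact: nbhs_right_lt.
  rewrite subr0 ler_pdivrMr//.
  have := @penaliser_convex _ _ hPsi 0 1 y.
  rewrite mulr0 mulr1 add0r => /(_ _ _ _ y0 y1) H.
  have := H (in01 _ _) (in01 _ _) _; rewrite eq_sym oner_neq0 !lexx !ler01.
  by move=> /(_ isT isT isT); nra.
rewrite /flux_ext clamp_id ?lexx ?ler01// clamp_ge1; last by lra.
by rewrite (penaliser_derivative1 hPsi hg); lra.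
Unshelve. all: by end_near. Qed.

(** * Lower bound and symmetry of the velocity *)

(** Replaces the discontinuous attraction terms by continuous ones. Terms with [x j] > [x i] are
    unchanged; those with [x j] < [x i] are nonnegative and absent ones count as 0, while the
    substitute is at most 0. The leading term offsets the artificial [flux_ext g 0] at j = i. *)
Lemma velocity_ge {R : realType} {Psi g : R -> R} {N : nat} {W : 'M[R]_N} :
  penaliser Psi -> is_derivative_on01 Psi g -> (forall i j, 0 <= W i j) ->
  forall (x : 'I_N -> R) i, (forall j, 0 < x j < 1) ->
  - (W i i * flux_ext g 0) +
    \sum_j W i j * (flux_ext g `|x j - x i| - flux_ext g (x j + x i))
  <= velocity Psi W x i.
Proof.
move=> hPsi hg W_ge0 x i x01.
rewrite /velocity [X in _ <= X - _]big_mkcond/= -sumrB.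
rewrite (bigD1 i)//= [leRHS](bigD1 i)//= eqxx /=.
have extE j : flux Psi (x j + x i) = flux_ext g (x j + x i).
  by apply: (flux_extE hPsi hg); have := x01 i; have := x01 j; lra.
rewrite addrA lerD//; first by rewrite subrr normr0 extE; lra.
apply: ler_sum => j _; rewrite extE mulrBr lerD2r.
have ext_le0 : flux_ext g `|x j - x i| <= 0.
  apply: (flux_ext_le0 hPsi hg); rewrite normr_ge0/= ler_norml.
  by have := x01 i; have := x01 j; lra.
case: ifPn => [|_]; last by rewrite mulr_ge0_le0.
rewrite neq_lt => /orP[xji|xij]; apply: ler_wpM2l => //.
  rewrite (le_trans ext_le0)// -[x j - x i]opprK fluxN (flux_extE hPsi hg).
    rewrite oppr_ge0; apply: (flux_ext_le0 hPsi hg).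
    by have := x01 i; have := x01 j; lra.
  by have := x01 i; have := x01 j; lra.
rewrite gtr0_norm ?subr_gt0// (flux_extE hPsi hg)//.
by have := x01 i; have := x01 j; lra.
Qed.

(** Differences of positions change sign and the flux is odd; sums s become 2 - s, and the extended
    flux is antisymmetric about 1. *)
Lemma velocity_refl {R : realType} {Psi g : R -> R} {N : nat} (W : 'M[R]_N) :
  penaliser Psi -> is_derivative_on01 Psi g ->
  forall (x : 'I_N -> R) i, (forall j, 0 < x j < 1) ->
  velocity Psi W (fun j => 1 - x j) i = - velocity Psi W x i.
Proof.
move=> hPsi hg x i x01; rewrite /velocity [RHS]opprD; congr (_ + _).
  rewrite -sumrN; apply: eq_big => j.
    by rewrite (inj_eq (addrI 1)) eqr_opp.
  by move=> _; rewrite -mulrN -fluxN; congr (_ * flux _ _); lra.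
congr (- _); rewrite -sumrN; apply: eq_bigr => j _.
rewrite -mulrN; congr (_ * _).
have xij : 0 < x j + x i < 2 by have := x01 i; have := x01 j; lra.
rewrite !(flux_extE hPsi hg)//; last by lra.
by rewrite -flux_ext_refl; congr flux_ext; lra.
Qed.

(** * Exclusion of the boundary at a first exit time *)

Lemma evolves_gt0 {R : realType} {Psi g : R -> R} {N : nat} {W : 'M[R]_N}
    {v : 'I_N -> R -> R} {T : R} :
  penaliser Psi -> {within `[0, 1], continuous g} -> is_derivative_on01 Psi g ->
  (forall i j, 0 <= W i j) -> (forall i, 0 < W i i) -> 0 < T ->
  (forall i, {within `[0, T], continuous (v i)}) ->
  (forall t : R, 0 < t < T -> forall i,
    is_derive t 1 (v i) (velocity Psi W (fun j => v j t) i)) ->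
  (forall t : R, 0 < t < T -> forall i, 0 < v i t < 1) ->
  forall i, 0 < v i T.
Proof.
move=> hPsi gc hg W_ge0 Wii T0 vc dv v01 i; rewrite ltNge; apply/negP => viT.
have vT j : v j t @[t --> T^'-] --> v j T.
  by have /(continuous_within_itvP _ T0)[] := vc j.
have vT0 j : 0 <= v j T.
  apply: (cvgr_to_ge (vT j)); near=> t; rewrite ltW//.
  have : 0 < t < T.
    by apply/andP; split; near: t; [exact: nbhs_left_gt|exact: nbhs_left_lt].
  by move=> /v01/(_ j)/andP[].
have {viT}viT : v i T = 0 by apply/eqP; rewrite eq_le viT vT0.
(* The bound of [velocity_ge] along the trajectory. Built from the continuous [flux_ext], it passes
   to the limit at [T], where [v i] reaches the jump of the flux. *)
pose L t := - (W i i * flux_ext g 0) +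
  \sum_j W i j * (flux_ext g `|v j t - v i t| - flux_ext g (v j t + v i t)).
have LT : L t @[t --> T^'-] --> L T.
  apply: cvgD; first exact: cvg_cst.
  apply: cvg_big => [|j _]; first exact: add_continuous.
  apply: cvgM; first exact: cvg_cst.
  have fc := continuous_flux_ext _ gc.
  apply: cvgB; apply: continuous_cvg; try exact: fc.
    by apply: cvg_norm; exact: cvgB.
  exact: cvgD.
have LT0 : 0 < L T.
  (* As [v i T] = 0 and [v j T] is nonnegative, distance and sum of the two positions agree, so
     every summand vanishes. *)
  rewrite /L big1 => [|j _]; last first.
    by rewrite viT subr0 addr0 ger0_norm// subrr mulr0.
  by rewrite addr0 oppr_gt0 pmulr_rlt0//; exact: (flux_ext0_lt0 hPsi hg).
have : nbhs T (fun t => t < T -> 0 < L t).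
  exact: (@cvgr_gt _ _ T^'- _ L _ LT 0 LT0).
move=> /nbhs_ballP[e /= e0 Le].
(* Halving the minimum keeps [t0] strictly between 0 and [T] and within [e] of [T]. *)
pose t0 := T - Num.min e T / 2.
have m0 : 0 < Num.min e T by rewrite lt_min e0.
have me : Num.min e T <= e by rewrite ge_min lexx.
have mT : Num.min e T <= T by rewrite ge_min lexx orbT.
have t0T : 0 < t0 < T by rewrite /t0; lra.
have /andP[t00 t0ltT] := t0T.
have dv' c : c \in `]t0, T[ ->
    is_derive c 1 (v i) (velocity Psi W (fun j => v j c) i).
  by rewrite in_itv /= => /andP[t0c cT]; apply: dv; rewrite cT (lt_trans t00).
have vc' : {within `[t0, T], continuous (v i)}.
  apply: continuous_subspaceW (vc i) => c /=.
  rewrite !in_itv /= => /andP[t0c ->].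
  by rewrite (le_trans (ltW t00)).
have [c] := MVT t0ltT dv' vc'; rewrite in_itv /= => /andP[t0c cT].
rewrite viT sub0r => vE.
have c0T : 0 < c < T by rewrite cT (lt_trans t00).
have : 0 < velocity Psi W (fun j => v j c) i.
  apply: lt_le_trans (velocity_ge hPsi hg W_ge0 _ i (v01 c c0T)).
  apply: (Le c) => //; rewrite /ball /= ger0_norm; last by lra.
  by move: t0c; rewrite /t0; lra.
(* By the mean value theorem - [v i t0] would be positive. *)
move=> /mulr_gt0 - /(_ (T - t0)); rewrite subr_gt0 -vE => /(_ t0ltT).
by have /andP[] := v01 t0 t0T i; lra.
Unshelve. all: by end_near. Qed.

Theorem theorem2 (R : realType) (Psi : R -> R) (hPsi : penaliser Psi)
    (N : nat) (W : 'M[R]_N)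
    (W_ge0 : forall i j, 0 <= W i j) (W_diag_gt0 : forall i, 0 < W i i)
    (J : set R) (J_itv : is_interval J) (J0 : J 0)
    (J_ge0 : forall t, J t -> 0 <= t)
    (v : 'I_N -> R -> R) (hv : evolves Psi W J v)
    (v_init : forall i, 0 < v i 0 < 1) :
  forall t, J t -> forall i, 0 < v i t < 1.
Proof.
have [g gc hg] := penaliser_C1 hPsi; have [vc dv] := hv.
move=> t1 Jt1 i; apply/negPn/negP => bad1.
(* The infimum of these bad times is the first exit time [T]. *)
pose B := [set t | 0 <= t <= t1 /\ exists i, ~~ (0 < v i t < 1)].
have t1_ge0 := J_ge0 _ Jt1.
have B0 : lbound B 0 by move=> t [/andP[]].
have infB : has_inf B.
  by split; [exists t1; split; [rewrite lexx andbT|exists i] | exists 0].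
pose T := inf B.
have T_ge0 : 0 <= T by apply: lb_le_inf => //; case: infB.
have T_le1 : T <= t1.
  by apply: ge_inf; [case: infB|split; [rewrite lexx andbT|exists i]].
have subJ t : 0 <= t <= t1 -> J t by move=> tt1; exact: J_itv tt1.
have good t j : 0 <= t < T -> 0 < v j t < 1.
  move=> /andP[t0 tT]; apply/negPn/negP => bad.
  have : T <= t; last by rewrite leNgt tT.
  apply: ge_inf; first by case: infB.
  by split; [rewrite t0 (le_trans (ltW tT)) | exists j].
(* The infimum is itself a bad time: otherwise continuity would keep all positions inside (0, 1) at
   times of [J] near [T], but bad times come arbitrarily close to [T]. *)
have badT : ~ (forall j, 0 < v j T < 1).
  move=> goodT.
  have : \forall t \near within J (nbhs T), forall j, 0 < v j t < 1.
    apply: filter_forall => j.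
    have /subspace_continuousP/(_ T (subJ T _)) := vc j.
    rewrite T_ge0 T_le1 => /(_ isT) vjT.
    have /andP[vj0 vj1] := goodT j.
    near=> t; apply/andP; split; near: t.
      exact: (cvgr_gt _ vjT).
    exact: (cvgr_lt _ vjT).
  rewrite near_withinE => /nbhs_ballP[e /= e0 He].
  have [t Bt tTe] := inf_adherent e0 infB.
  have Tt : T <= t by apply: ge_inf => //; case: infB.
  have [tt1 [j /negP]] := Bt; apply; apply: He; last exact: subJ.
  by rewrite /ball /= ler0_norm; move: tTe; rewrite -/T; lra.
have T0 : 0 < T.
  by rewrite lt_neqAle T_ge0 andbT; apply/eqP => T0; apply: badT; rewrite -T0.
apply: badT => j.
have good' t : 0 < t < T -> forall k, 0 < v k t < 1.
  by move=> /andP[t0 tT] k; apply: good; rewrite ltW.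
have vcT k : {within `[0, T], continuous (v k)}.
  apply: continuous_subspaceW (vc k) => t /=; rewrite in_itv /= => /andP[t0 tT].
  by apply: subJ; rewrite t0 (le_trans tT).
have dvT t : 0 < t < T -> forall k,
    is_derive t 1 (v k) (velocity Psi W (fun j => v j t) k).
  move=> t0T; apply: dv; last exact: good'.
  (* The equation is available only at interior times of [J]; an open interval contained in [J]
     consists of such times. *)
  have : `]0, T[%classic `<=` J°.
    rewrite -open_subsetE; last exact: itv_open.
    move=> s /=; rewrite in_itv /= => /andP[s0 sT].
    by apply: subJ; rewrite ltW//= ltW// (lt_le_trans sT).
  by apply; rewrite /= in_itv.
rewrite (evolves_gt0 hPsi gc hg W_ge0 W_diag_gt0 T0 vcT dvT good')/=.
(* What remains is [v j T] < 1, that is, positivity of the reflected solution. *)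
rewrite -subr_gt0.
apply: (evolves_gt0 (v := fun k t => 1 - v k t) hPsi gc hg W_ge0 W_diag_gt0 T0).
- move=> k; apply: within_continuousB; last exact: vcT.
  exact: continuous_subspaceT (@cst_continuous _ _ _).
- move=> t t0T k; rewrite (velocity_refl W hPsi hg)//; last exact: good'.
  have dvk := dvT t t0T k; by apply: is_derive_eq; rewrite ?sub0r ?add0r mul1r.
- by move=> t t0T k; have := good' t t0T k; lra.
Unshelve. all: by end_near. Qed.
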